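(* Consider the sequence of pairs $(PP,PG)$ produced by the successive-product algorithm described in the context, started at $PP=\lambda_{0,1}=2/3$ and $PG=\lambda_{1,0}=4/3$. Let $\lambda_{k_1,k_2}$ be any value occurring as a $PP$ or a $PG$ in this algorithm, together with its associated pair $(k_1,k_2)$ and $k=k_1+k_2$. Then: (i) $\lambda_{k_1,k_2}$ corresponds to a maximum of $C$ on its side of $1$: for every pair of nonnegative integers $(k_1',k_2')$ with $1\le k_1'+k_2'\le k_1+k_2$ such that $\lambda_{k_1',k_2'}$ lies on the same side of $1$ as $\lambda_{k_1,k_2}$ (both $<1$ or both $>1$), one has $C(k_1',k_2')\le C(k_1,k_2)$. (ii) The values get gradually closer to $1$ as $k$ increases: each newly produced $PP$ satisfies $PP_{\mathrm{old}}<PP_{\mathrm{new}}<1$, and each newly produced $PG$ satisfies $1<PG_{\mathrm{new}}<PG_{\mathrm{old}}$.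
   Context: For nonnegative integers $k_1,k_2$ put $\lambda_{k_1,k_2}=\left(\frac43\right)^{k_1}\left(\frac23\right)^{k_2}$. For $(k_1,k_2)\ne(0,0)$ put $C(k_1,k_2)=\dfrac{7/24}{\frac1{k_1}\left|\ln \lambda_{k_1,k_2}\right|}$ if $k_1\ge1$, and $C(0,k_2)=0$. Algorithm of successive products: at each stage one has a current value $PP<1$ with an associated pair $(a_1,a_2)$, $PP=\lambda_{a_1,a_2}$, and a current value $PG>1$ with an associated pair $(b_1,b_2)$, $PG=\lambda_{b_1,b_2}$. Start with $PP=2/3$, $(a_1,a_2)=(0,1)$ and $PG=4/3$, $(b_1,b_2)=(1,0)$. At each step form the product $PP\cdot PG=\lambda_{a_1+b_1,\,a_2+b_2}$. If the product is $<1$, it becomes the new $PP$, with associated pair $(a_1+b_1,a_2+b_2)$, and $PG$ is unchanged; if the product is $>1$, it becomes the new $PG$, with associated pair $(a_1+b_1,a_2+b_2)$, and $PP$ is unchanged. (The product is never equal to $1$.) Repeat indefinitely. *)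

(* Defs.v *)
From Stdlib Require Import Reals Lra Lia.
Open Scope R_scope.

Definition lambda (k1 k2 : nat) : R := (4 / 3) ^ k1 * (2 / 3) ^ k2.

(* The convention C(0, k2) = 0 is also applied at (0, 0), where the
   mathematical C is not defined. *)
Definition Cval (k1 k2 : nat) : R :=
  match k1 with
  | O => 0
  | S _ => (7 / 24) / ((1 / INR k1) * Rabs (ln (lambda k1 k2)))
  end.

Definition same_side (x y : R) : Prop := (x < 1 /\ y < 1) \/ (1 < x /\ 1 < y).

Record state : Type := State { PPpair : nat * nat; PGpair : nat * nat }.

Definition PP (s : state) : R := lambda (fst (PPpair s)) (snd (PPpair s)).
Definition PG (s : state) : R := lambda (fst (PGpair s)) (snd (PGpair s)).

Definition add_pair (a b : nat * nat) : nat * nat :=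
  ((fst a + fst b)%nat, (snd a + snd b)%nat).

Definition init : state := State (0, 1)%nat (1, 0)%nat.

(* The last branch, product equal to 1, is never taken: see [run_neq_1]. *)
Definition step (s : state) : state :=
  if Rlt_dec (PP s * PG s) 1 then
    State (add_pair (PPpair s) (PGpair s)) (PGpair s)
  else if Rlt_dec 1 (PP s * PG s) then
    State (PPpair s) (add_pair (PPpair s) (PGpair s))
  else s.

Fixpoint run (n : nat) : state :=
  match n with
  | O => init
  | S m => step (run m)
  end.

Lemma lambda_add (a1 a2 b1 b2 : nat) :
  lambda a1 a2 * lambda b1 b2 = lambda (a1 + b1) (a2 + b2).
Proof. unfold lambda; rewrite !pow_add; ring. Qed.

Lemma PP_PG_lambda (s : state) :
  PP s * PG s = lambda (fst (add_pair (PPpair s) (PGpair s)))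
                       (snd (add_pair (PPpair s) (PGpair s))).
Proof. apply lambda_add. Qed.

Lemma lambda_neq_1 (k1 k2 : nat) : (1 <= k1 + k2)%nat -> lambda k1 k2 <> 1.
Proof.
intros Hk H.
assert (E : 2 ^ (2 * k1 + k2) = 3 ^ (k1 + k2)).
{ assert (H3 : 3 ^ (k1 + k2) <> 0) by (apply pow_nonzero; lra).
  replace (2 ^ (2 * k1 + k2)) with (lambda k1 k2 * 3 ^ (k1 + k2)).
  - rewrite H; ring.
  - unfold lambda, Rdiv.
    rewrite !Rpow_mult_distr, !pow_add, pow_mult, !pow_inv.
    replace (2 ^ 2) with 4 by ring.
    field; split; apply pow_nonzero; lra. }
change 2 with (INR 2) in E at 1.
replace 3 with (INR 3) in E by (simpl; ring).
rewrite <- !pow_INR in E; apply INR_eq in E.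
apply (f_equal Nat.even) in E.
rewrite !Nat.even_pow in E by lia.
discriminate.
Qed.

Lemma run_neq_1 (n : nat) : PP (run n) * PG (run n) <> 1.
Proof.
rewrite PP_PG_lambda; apply lambda_neq_1.
enough (1 <= fst (PGpair (run n)))%nat by (unfold add_pair; simpl; lia).
induction n as [|n IH]; [simpl; lia|].
cbn [run]; unfold step.
destruct Rlt_dec; [exact IH|].
destruct Rlt_dec; [unfold add_pair; simpl; lia|exact IH].
Qed.

(* Main.v *)
Require Import Defs.
From Stdlib Require Import Reals Lra Lia.
Open Scope R_scope.

(** Taking logarithms, [ln (lambda k1 k2)] is the linear form
    [k1 * ln (4/3) + k2 * ln (2/3)] in the lattice point [(k1, k2)].  On one
    side of 1, [Cval k1 k2] is a positive multiple of
    [k1 / |ln (lambda k1 k2)|], which depends only on the slope [k2 / k1] and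
    increases as this slope approaches the irrational slope at which the form
    vanishes.  So (i) says that the pairs met by the algorithm are best
    one-sided approximations of that slope, among the pairs whose sum of
    coordinates is no larger.

    The algorithm is a walk down the Stern-Brocot tree: the pairs
    [a = (a1, a2)] of [PP] and [b = (b1, b2)] of [PG] enclose the critical
    slope and keep the determinant [a2 * b1 - a1 * b2 = 1] ([run_unimodular]).
    They therefore form a basis of the lattice, and a lattice point [c] whose
    slope lies strictly between theirs has both coordinates at least 1 in this
    basis, so its sum of coordinates is at least that of [a + b]
    ([sum_ge_of_between]).  A pair [c] that beats [a] or [b] on the same side
    of 1 has such a slope: on one side because it is better, on the other
    because [lambda] separates slopes across 1 ([slope_lt_of_sides]).  Hence
    its sum exceeds those of [a] and [b], which is excluded.

    Part (ii) holds because [PP < 1 < PG] throughout: multiplying [PP] by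
    [PG] increases it, and multiplying [PG] by [PP] decreases it. *)

(** * The logarithm of [lambda] as a linear form *)

Lemma lambda_pos (k1 k2 : nat) : 0 < lambda k1 k2.
Proof. apply Rmult_lt_0_compat; apply pow_lt; lra. Qed.

Lemma ln_lambda (k1 k2 : nat) :
  ln (lambda k1 k2) = INR k1 * ln (4 / 3) + INR k2 * ln (2 / 3).
Proof.
unfold lambda; rewrite ln_mult by (apply pow_lt; lra).
rewrite !ln_pow by lra; reflexivity.
Qed.

Lemma ln_two_thirds_neg : ln (2 / 3) < 0.
Proof. rewrite <- ln_1; apply ln_increasing; lra. Qed.

Lemma ln_lambda_neg (k1 k2 : nat) : lambda k1 k2 < 1 -> ln (lambda k1 k2) < 0.
Proof.
intros H; rewrite <- ln_1; apply ln_increasing; [apply lambda_pos | exact H].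
Qed.

Lemma ln_lambda_gt0 (k1 k2 : nat) : 1 < lambda k1 k2 -> 0 < ln (lambda k1 k2).
Proof. intros H; rewrite <- ln_1; apply ln_increasing; lra. Qed.

(** Eliminating [ln (4/3)] between two values of the form leaves only a
    determinant, so comparing two values of [Cval] is a question about
    integers. *)
Lemma ln_lambda_cross (k1 k2 c1 c2 : nat) :
  INR c1 * ln (lambda k1 k2) - INR k1 * ln (lambda c1 c2)
  = (INR (c1 * k2) - INR (k1 * c2)) * ln (2 / 3).
Proof. rewrite !ln_lambda, !mult_INR; ring. Qed.

Lemma slope_lt_of_sides (a1 a2 b1 b2 : nat) :
  lambda a1 a2 < 1 -> 1 < lambda b1 b2 -> (a1 * b2 < a2 * b1)%nat.
Proof.
intros Ha Hb.
apply ln_lambda_neg in Ha; apply ln_lambda_gt0 in Hb.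
pose proof ln_two_thirds_neg as Hneg.
pose proof (ln_lambda_cross b1 b2 a1 a2) as E.
(* [b1 = 0] would make the form nonpositive at [b]. *)
assert (Hb1 : 0 < INR b1).
{ destruct b1 as [|b1]; [|apply lt_0_INR; lia].
  rewrite ln_lambda in Hb; simpl INR in Hb.
  pose proof (pos_INR b2); nra. }
pose proof (pos_INR a1) as Ha1.
apply INR_lt; rewrite (Nat.mul_comm a2 b1).
assert (0 < (INR (a1 * b2) - INR (b1 * a2)) * ln (2 / 3))
  by (rewrite <- E; nra).
nra.
Qed.

(** * Comparing values of [C] *)

Lemma Cval_le_of_cross (k1 k2 c1 c2 : nat) :
  ln (lambda k1 k2) <> 0 -> ln (lambda c1 c2) <> 0 ->
  INR c1 * Rabs (ln (lambda k1 k2)) <= INR k1 * Rabs (ln (lambda c1 c2)) ->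
  Cval c1 c2 <= Cval k1 k2.
Proof.
intros Hk Hc H.
assert (Cval_quot : forall m1 m2, ln (lambda m1 m2) <> 0 ->
  Cval m1 m2 = 7 / 24 * (INR m1 / Rabs (ln (lambda m1 m2)))).
{ intros [|m] m2 Hm; unfold Cval.
  - simpl INR; unfold Rdiv; ring.
  - field; split; [apply Rabs_no_R0; exact Hm | apply not_0_INR; lia]. }
rewrite !Cval_quot by assumption.
apply Rmult_le_compat_l; [lra|].
apply Rabs_pos_lt in Hk; apply Rabs_pos_lt in Hc.
apply Rmult_le_reg_r with
  (Rabs (ln (lambda k1 k2)) * Rabs (ln (lambda c1 c2))).
- apply Rmult_lt_0_compat; assumption.
- field_simplify; lra.
Qed.

(** Below 1 a smaller slope [k2 / k1] is nearer to the critical one; above 1 a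
    larger slope is.  Hence the opposite inequalities in the next two lemmas. *)
Lemma Cval_le_below (k1 k2 c1 c2 : nat) :
  lambda k1 k2 < 1 -> lambda c1 c2 < 1 -> (c1 * k2 <= k1 * c2)%nat ->
  Cval c1 c2 <= Cval k1 k2.
Proof.
intros Hk Hc H.
apply ln_lambda_neg in Hk; apply ln_lambda_neg in Hc.
apply Cval_le_of_cross; try lra.
rewrite !Rabs_left by assumption.
pose proof (ln_lambda_cross k1 k2 c1 c2).
pose proof ln_two_thirds_neg.
apply le_INR in H; nra.
Qed.

Lemma Cval_le_above (k1 k2 c1 c2 : nat) :
  1 < lambda k1 k2 -> 1 < lambda c1 c2 -> (k1 * c2 <= c1 * k2)%nat ->
  Cval c1 c2 <= Cval k1 k2.
Proof.
intros Hk Hc H.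
apply ln_lambda_gt0 in Hk; apply ln_lambda_gt0 in Hc.
apply Cval_le_of_cross; try lra.
rewrite !Rabs_pos_eq by lra.
pose proof (ln_lambda_cross k1 k2 c1 c2).
pose proof ln_two_thirds_neg.
apply le_INR in H; nra.
Qed.

(** * Unimodular pairs *)

(** In the lattice basis [a], [b] the point [c] has coordinates
    [x = c2 * b1 - c1 * b2] and [y = c1 * a2 - a1 * c2], by Cramer's rule; the
    two slope inequalities say exactly that [x] and [y] are at least 1. *)
Lemma sum_ge_of_between (a1 a2 b1 b2 c1 c2 : nat) :
  (a2 * b1 = a1 * b2 + 1 -> a1 * c2 < a2 * c1 -> c1 * b2 < c2 * b1 ->
   (a1 + a2) + (b1 + b2) <= c1 + c2)%nat.
Proof.
intros Hdet Ha Hb.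
assert (Hx : exists x, (c2 * b1 = c1 * b2 + S x)%nat)
  by (exists (c2 * b1 - c1 * b2 - 1)%nat; lia).
assert (Hy : exists y, (a2 * c1 = a1 * c2 + S y)%nat)
  by (exists (a2 * c1 - a1 * c2 - 1)%nat; lia).
destruct Hx as [x Hx]; destruct Hy as [y Hy].
assert (E1 : (c1 = S x * a1 + S y * b1)%nat) by nia.
assert (E2 : (c2 = S x * a2 + S y * b2)%nat) by nia.
nia.
Qed.

(** * Invariants of the algorithm *)

Lemma run_sides (n : nat) : PP (run n) < 1 < PG (run n).
Proof.
induction n as [|n IH].
- unfold PP, PG, lambda; simpl; lra.
- cbn [run]; unfold step.
  destruct Rlt_dec as [H|H]; [|destruct Rlt_dec as [H'|H']; [|exact IH]].
  + rewrite PP_PG_lambda in H; split; [exact H | apply IH].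
  + rewrite PP_PG_lambda in H'; split; [apply IH | exact H'].
Qed.

(** Replacing either vector by the sum of the two is a determinant-preserving
    column operation. *)
Lemma run_unimodular (n : nat) :
  (snd (PPpair (run n)) * fst (PGpair (run n))
   = fst (PPpair (run n)) * snd (PGpair (run n)) + 1)%nat.
Proof.
induction n as [|n IH]; [reflexivity|].
cbn [run]; unfold step.
destruct Rlt_dec; [|destruct Rlt_dec; [|exact IH]];
  unfold add_pair; simpl; nia.
Qed.

(** * The theorem *)

Theorem theorem2p3 :
  (forall n k1 k2 : nat,
      PPpair (run n) = (k1, k2) \/ PGpair (run n) = (k1, k2) ->
      forall k1' k2' : nat,
        (1 <= k1' + k2' <= k1 + k2)%nat ->
        same_side (lambda k1' k2') (lambda k1 k2) ->
        Cval k1' k2' <= Cval k1 k2)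
  /\
  (forall n : nat,
      (PP (run n) * PG (run n) < 1 -> PP (run n) < PP (run (S n)) < 1) /\
      (1 < PP (run n) * PG (run n) -> 1 < PG (run (S n)) < PG (run n))).
Proof.
split.
- intros n k1 k2 Hk c1 c2 Hc Hside.
  pose proof (run_sides n) as [HP HG].
  pose proof (run_unimodular n) as Hdet.
  unfold PP in HP; unfold PG in HG.
  destruct (PPpair (run n)) as [a1 a2]; destruct (PGpair (run n)) as [b1 b2].
  simpl fst in *; simpl snd in *.
  destruct Hk as [E|E]; injection E as <- <-.
  + destruct Hside as [[Hc1 _]|[_ Hc1]]; [|lra].
    apply Cval_le_below; [assumption..|].
    destruct (Nat.le_gt_cases (c1 * a2) (a1 * c2)) as [|Hlt]; [assumption|].
    pose proof (slope_lt_of_sides _ _ _ _ Hc1 HG) as Hb.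
    pose proof (sum_ge_of_between a1 a2 b1 b2 c1 c2 Hdet
                  ltac:(lia) Hb) as Hsum.
    (* The determinant forbids [b = (0, 0)], so the sum is too large. *)
    assert (b1 <> 0)%nat by (intros ->; lia); lia.
  + destruct Hside as [[_ Hc1]|[Hc1 _]]; [lra|].
    apply Cval_le_above; [assumption..|].
    destruct (Nat.le_gt_cases (b1 * c2) (c1 * b2)) as [|Hlt]; [assumption|].
    pose proof (slope_lt_of_sides _ _ _ _ HP Hc1) as Ha.
    pose proof (sum_ge_of_between a1 a2 b1 b2 c1 c2 Hdet
                  Ha ltac:(lia)) as Hsum.
    assert (a2 <> 0)%nat by (intros ->; lia); lia.
- intros n.
  pose proof (run_sides n) as [HP HG].
  assert (HP0 : 0 < PP (run n)) by apply lambda_pos.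
  cbn [run]; unfold step; split; intros H.
  + destruct Rlt_dec as [_|]; [|contradiction].
    unfold PP at 2 3; cbn [PPpair].
    rewrite <- PP_PG_lambda; nra.
  + destruct Rlt_dec as [|_]; [lra|].
    destruct Rlt_dec as [_|]; [|contradiction].
    unfold PG at 1 2; cbn [PGpair].
    rewrite <- PP_PG_lambda; nra.
Qed.
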